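(* Let $\mathbb{P}$ be a multiplicative subsemigroup of $\mathbb{N}=\{1,2,3,\dots\}$. (a) Every $\mathbb{P}$-torsion-free cone embeds strongly unitarily into a $\mathbb{P}$-torsion-free refinement cone. (b) Every directed $\mathbb{P}$-torsion-free partially ordered abelian group $A$ embeds cofinally into a $\mathbb{P}$-torsion-free Riesz group $B$ such that $B/A$ is torsion-free. (c) Every $\mathbb{P}$-torsion-free $\mathbb{P}$-unperforated cone order-embeds into a $\mathbb{P}$-torsion-free $\mathbb{P}$-unperforated normally divisible refinement cone. (d) Every directed $\mathbb{P}$-unperforated partially ordered abelian group $A$ embeds cofinally into a $\mathbb{P}$-unperforated Riesz group $B$ such that $B/A$ is torsion-free.
   Context: Commutative monoids are written additively. The algebraic preordering of a commutative monoid $M$ is $x\le y\iff(\exists z\in M)(x+z=y)$. A cone is a commutative monoid that is conical: $x+y=0\Rightarrow x=y=0$. A multiplicative subsemigroup is a nonempty subset closed under multiplication. A commutative monoid (or abelian group) is $\mathbb{P}$-torsion-free if for all $p\in\mathbb{P}$, $px=py\Rightarrow x=y$. A commutative monoid with its algebraic preordering (or a partially ordered abelian group with its order) is $\mathbb{P}$-unperforated if for all $p\in\mathbb{P}$, $px\le py\Rightarrow x\le y$. A refinement cone is a cone with the refinement property: whenever $a_0+a_1=b_0+b_1$ there are $c_{ij}$ ($i,j<2$) with $a_i=c_{i0}+c_{i1}$ and $b_i=c_{0i}+c_{1i}$ for all $i<2$. A commutative monoid $M$ is normally divisible if for every positive integer $p$, every finite subset $X\subseteq M$ and every $a\in M$,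 there is $u\in M$ with $pu=a$ and, for all $x,y\in X$, $x+a=y+a\Rightarrow x+u=y+u$. An order-embedding $f:M\to N$ of commutative monoids is an injective monoid homomorphism with $x\le y\iff f(x)\le f(y)$ for the algebraic preorderings. A homomorphism $f:A\to B$ of commutative monoids is strongly unitary if it is one-to-one, has cofinal image (every $b\in B$ satisfies $b\le f(a)$ for some $a\in A$), for all $a_0,a_1\in A$, $b\in B$, $f(a_0)+b=f(a_1)$ implies $b\in f[A]$, and for all positive integers $m$ and $b\in B$, $mb\in f[A]$ implies $b\in f[A]$. A partially ordered abelian group is an abelian group $G$ with a translation-invariant partial order; it is directed if every element is a difference of two elements $\ge0$. An embedding $f:A\to B$ of partially ordered abelian groups is an injective group homomorphism such that $x\ge0\iff f(x)\ge0$; it is cofinal if every $b\in B$ satisfies $b\le f(a)$ for some $a\in A$; $A$ is identified with its image when writing $B/A$. A Riesz group is a directed partially ordered abelian group with the interpolation property: whenever $x_0,x_1\le y_0,y_1$ there is $z$ with $x_0,x_1\le z\le y_0,y_1$ (equivalently, the positive cone is a refinement monoid). *)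

(* Defs.v *)
From HB Require Import structures.
From mathcomp Require Import all_boot all_order all_algebra.
From mathcomp Require Import boolp classical_sets.

Set Implicit Arguments.
Unset Strict Implicit.
Unset Printing Implicit Defensive.

Import GRing.Theory.

Local Open Scope classical_set_scope.
Local Open Scope ring_scope.

Definition positive_nat : set nat := [set n | (0 < n)%N].

Definition multiplicative_subsemigroup (P : set nat) : Prop :=
  [/\ P `<=` positive_nat, P !=set0 &
      forall m n : nat, P m -> P n -> P (m * n)%N].

Definition alg_le (M : nmodType) (x y : M) : Prop := exists z, x + z = y.

Definition cone (M : nmodType) : Prop :=
  forall x y : M, x + y = 0 -> x = 0 /\ y = 0.

Definition torsion_free_for (P : set nat) (M : nmodType) : Prop :=
  forall p, P p -> forall x y : M, x *+ p = y *+ p -> x = y.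

(* [le] is [@alg_le M] for a monoid, and the given order for a partially
   ordered abelian group. *)
Definition unperforated_for (P : set nat) (M : nmodType)
    (le : M -> M -> Prop) : Prop :=
  forall p, P p -> forall x y : M, le (x *+ p) (y *+ p) -> le x y.

Definition refinement_property (M : nmodType) : Prop :=
  forall a0 a1 b0 b1 : M, a0 + a1 = b0 + b1 ->
  exists c00 c01 c10 c11 : M,
    [/\ a0 = c00 + c01, a1 = c10 + c11, b0 = c00 + c10 & b1 = c01 + c11].

Definition refinement_cone (M : nmodType) : Prop :=
  cone M /\ refinement_property M.

Definition normally_divisible (M : nmodType) : Prop :=
  forall (p : nat) (X : seq M) (a : M), (0 < p)%N ->
  exists u : M, u *+ p = a /\
    forall x y : M, x \in X -> y \in X -> x + a = y + a -> x + u = y + u.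

Definition cofinal (A B : Type) (le : B -> B -> Prop) (f : A -> B) : Prop :=
  forall b, exists a, le b (f a).

Definition order_embedding (M N : nmodType) (f : {additive M -> N}) : Prop :=
  injective f /\ forall x y : M, alg_le x y <-> alg_le (f x) (f y).

Definition strongly_unitary (A B : nmodType) (f : {additive A -> B}) : Prop :=
  [/\ injective f,
      cofinal (@alg_le B) f,
      forall (a0 a1 : A) (b : B), f a0 + b = f a1 -> range f b &
      forall (m : nat) (b : B), (0 < m)%N -> range f (b *+ m) -> range f b].

(* [porderZmodType] does not relate the order to the addition, so translation
   invariance is required explicitly. *)
Definition po_group (G : porderZmodType) : Prop :=
  forall x y z : G, x <= y -> x + z <= y + z.

Definition po_le (G : porderZmodType) (x y : G) : Prop := x <= y.

Definition directed (G : porderZmodType) : Prop :=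
  forall x : G, exists y z : G, [/\ 0 <= y, 0 <= z & x = y - z].

Definition interpolation (G : porderZmodType) : Prop :=
  forall x0 x1 y0 y1 : G, x0 <= y0 -> x0 <= y1 -> x1 <= y0 -> x1 <= y1 ->
  exists z : G, [/\ x0 <= z, x1 <= z, z <= y0 & z <= y1].

Definition riesz_group (G : porderZmodType) : Prop :=
  [/\ po_group G, directed G & interpolation G].

Definition po_embedding (A B : porderZmodType) (f : {additive A -> B}) : Prop :=
  injective f /\ forall x : A, 0 <= x <-> 0 <= f x.

Definition image_pred (A B : zmodType) (f : {additive A -> B}) : {pred B} :=
  fun b => `[< range f b >].

Lemma image_pred_zmod_closed (A B : zmodType) (f : {additive A -> B}) :
  zmod_closed (image_pred f).
Proof.
split; first by apply/asboolP; exists 0; rewrite ?raddf0.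
move=> x y /asboolP[a _ <-] /asboolP[b _ <-].
by apply/asboolP; exists (a - b); rewrite ?raddfB.
Qed.

HB.instance Definition _ (A B : zmodType) (f : {additive A -> B}) :=
  GRing.isZmodClosed.Build B (image_pred f) (image_pred_zmod_closed f).

(* The quotient group B / f[A]. *)
Definition cokernel (A B : zmodType) (f : {additive A -> B}) : zmodType :=
  Quotient.quot (image_pred f).

Definition torsion_free (G : zmodType) : Prop :=
  torsion_free_for positive_nat G.

(* Main.v *)
(* Given a cone M and equations a0 + a1 = b0 + b1 between nonzero elements,
   adjoin letters c00, c01, c10, c11 for each of them.  A word in these letters
   and in M is graded by the integers n00 - n01 - n10 + n11, and a word of degree
   0 has a well-defined value in M: pair each c00 or c11 with a c01 or c10 and
   replace the pair by its sum a_i or b_j; the equation makes the result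
   independent of the pairing.  Identify two words x, y when, for some p in P,
   p x and p y have the same value in every context.  This syntactic congruence
   turns P-torsion-freeness of M into P-torsion-freeness of the quotient, and M is
   exactly the part of degree 0, whence the strong unitarity.  Iterating omega
   times gives (a).  Carrying along a submonoid of positive elements (for (d),
   closed under division by elements of P) the same step applied to an abelian
   group stays inside groups, which gives (b) and (d).

   For (c) one alternates with the adjunction of some u with p u = a, graded by
   Z/p, the words of degree 0 being evaluated by replacing p u by a.  For words
   of nonzero degree only the values of their sums with words containing u
   matter, so that x + a = y + a implies x + u = y + u.  In the limit,
   P-torsion-freeness and divisibility imply P-unperforation. *)

From HB Require Import structures.
Require Import Defs.
From mathcomp Require Import all_boot all_order all_algebra.
From mathcomp Require Import boolp classical_sets zify ssrAC.

Set Implicit Arguments.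
Unset Strict Implicit.
Unset Printing Implicit Defensive.

Import Order.TTheory GRing.Theory.

Local Open Scope quotient_scope.
Local Open Scope ring_scope.

(** * Quotients, products and direct limits of commutative monoids *)

Section QuotientMonoid.
Variables (F : nmodType) (e : rel F).
Hypotheses (e_refl : reflexive e) (e_sym : symmetric e) (e_trans : transitive e).
Hypothesis (e_add : forall x y z, e x y -> e (x + z) (y + z)).

Let eqv := EquivRel e e_refl e_sym e_trans.
Definition quotient_monoid : Type := {eq_quot eqv}.
HB.instance Definition _ := Choice.on quotient_monoid.

Let cls (x : F) : quotient_monoid := \pi_({eq_quot eqv}) x.
Let rep (x : quotient_monoid) : F := repr (x : {eq_quot eqv}).

Let cls_eq x y : cls x = cls y <-> e x y.
Proof. by split=> [/eqmodP|?] //; apply/eqmodP. Qed.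

Let repK : cancel rep cls.
Proof. exact: reprK. Qed.

Let clsK x : e (rep (cls x)) x.
Proof. by apply/cls_eq; rewrite repK. Qed.

Let addq x y := cls (rep x + rep y).

Let addqE x y : addq (cls x) (cls y) = cls (x + y).
Proof.
apply/cls_eq/(e_trans (y := x + rep (cls y))); first exact/e_add/clsK.
by rewrite addrC [x + y]addrC; apply/e_add/clsK.
Qed.

Let addqA : associative addq.
Proof.
by move=> x y z; rewrite -[x]repK -[y]repK -[z]repK !addqE addrA.
Qed.

Let addqC : commutative addq.
Proof. by move=> x y; rewrite /addq addrC. Qed.

Let add0q : left_id (cls 0) addq.
Proof. by move=> x; rewrite -[x]repK addqE add0r. Qed.

HB.instance Definition _ :=
  GRing.isNmodule.Build quotient_monoid addqA addqC add0q.

Let cls_nmod : nmod_morphism (cls : F -> quotient_monoid).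
Proof. by split=> // x y; rewrite -addqE. Qed.

HB.instance Definition _ := GRing.isNmodMorphism.Build F quotient_monoid cls cls_nmod.

Lemma quotient_monoid_exists :
  exists (N : nmodType) (pi : {additive F -> N}),
    (forall z, exists x, pi x = z) /\ forall x y, pi x = pi y <-> e x y.
Proof.
by exists quotient_monoid, cls; split=> [z|]; [exists (rep z); apply: repK|exact: cls_eq].
Qed.
End QuotientMonoid.

Lemma congruence_quotient (F : nmodType) (e : F -> F -> Prop) :
  (forall x, e x x) -> (forall x y, e x y -> e y x) ->
  (forall x y z, e x y -> e y z -> e x z) ->
  (forall x y z, e x y -> e (x + z) (y + z)) ->
  exists (N : nmodType) (pi : {additive F -> N}),
    (forall z, exists x, pi x = z) /\ forall x y, pi x = pi y <-> e x y.
Proof.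
move=> er es et ea.
have [||||N [pi [pi_surj pi_eq]]] := @quotient_monoid_exists F (fun x y => `[< e x y >]).
- by move=> x; apply/asboolP.
- by move=> x y; apply/asboolP/asboolP; apply: es.
- by move=> y x z /asboolP exy /asboolP eyz; apply/asboolP; apply: et eyz.
- by move=> x y z /asboolP exy; apply/asboolP; apply: ea.
by exists N, pi; split=> // x y; rewrite pi_eq; split=> /asboolP.
Qed.

Lemma submonoid_exists (F : nmodType) (S : F -> Prop) :
  S 0 -> (forall x y, S x -> S y -> S (x + y)) ->
  exists (N : nmodType) (i : {additive N -> F}),
    injective i /\ forall x, S x <-> exists y, i y = x.
Proof.
move=> S0 SD; pose p : {pred F} := fun x => `[< S x >].
have pC : GRing.nmod_closed p.
  by split=> [|x y /asboolP Sx /asboolP Sy]; apply/asboolP; [|apply: SD].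
pose N0 : Type := {x | p x}.
pose NM := GRing.SubChoice_isSubNmodule.Build F p {x | p x} pC.
pose N : subNmodType p := HB.pack {x | p x} NM.
exists N, (val : N -> F); split=> [|x]; first exact: val_inj.
split=> [/asboolP Sx|[y <-]]; first by exists (exist _ x Sx).
by apply/asboolP; apply: (valP y).
Qed.

Definition product_monoid (I : Type) (M : I -> nmodType) : Type := forall i, M i.

Section ProductMonoid.
Variables (I : Type) (M : I -> nmodType).
HB.instance Definition _ := gen_eqMixin (product_monoid M).
HB.instance Definition _ := gen_choiceMixin (product_monoid M).
Let zero : product_monoid M := fun=> 0.
Let add (x y : product_monoid M) : product_monoid M := fun i => x i + y i.
Let addA : associative add.
Proof. by move=> x y z; apply: functional_extensionality_dep => i; apply: addrA. Qed.
Let addC : commutative add.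
Proof. by move=> x y; apply: functional_extensionality_dep => i; apply: addrC. Qed.
Let add0 : left_id zero add.
Proof. by move=> x; apply: functional_extensionality_dep => i; apply: add0r. Qed.
HB.instance Definition _ := GRing.isNmodule.Build (product_monoid M) addA addC add0.

Lemma product_monoidD (x y : product_monoid M) i : (x + y) i = x i + y i.
Proof. by []. Qed.
End ProductMonoid.

(** * Direct limits of sequences of injective homomorphisms *)

Section DirectLimit.
Variables (M : nat -> nmodType) (f : forall n, {additive M n -> M n.+1}).
Hypothesis f_inj : forall n, injective (f n).

Let coherent_from k (s : product_monoid M) :=
  forall n, (k <= n)%N -> s n.+1 = f n (s n).

(** The family that is 0 before stage [n], [x] at stage [n] and the successive images of [x]
    afterwards; [dfwith] avoids a transport along an equality of stages. *)
Fixpoint thread n (x : M n) k : M k :=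
  match k return M k with
  | 0 => @dfwith _ M (fun=> 0) n x 0
  | k'.+1 => if (n <= k')%N then f k' (thread x k') else @dfwith _ M (fun=> 0) n x k'.+1
  end.

Let thread_refl n (x : M n) : thread x n = x.
Proof. by case: n x => [|n] x /=; rewrite ?ltnn dfwith_in. Qed.

Let thread_coherent n (x : M n) : coherent_from n (thread x).
Proof. by move=> k /= ->. Qed.

Let agree_down n k (s t : product_monoid M) :
  coherent_from n s -> coherent_from n t -> (n <= k)%N -> s k = t k -> s n = t n.
Proof.
move=> cs ct; elim: k => [|k IH]; first by rewrite leqn0 => /eqP->.
rewrite leq_eqVlt => /predU1P[<-//|nk].
by rewrite cs // ct // => /f_inj; apply: IH.
Qed.

Let agree_up n k (s t : product_monoid M) :
  coherent_from n s -> coherent_from n t -> (n <= k)%N -> s n = t n -> s k = t k.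
Proof.
move=> cs ct nk eq_n; elim: k nk => [|k IH]; first by rewrite leqn0 => /eqP<-.
by rewrite leq_eqVlt => /predU1P[<-//|nk]; rewrite cs // ct // IH.
Qed.

(** Eventually coherent families form a submonoid of the product, and the limit is its quotient by
    eventual equality. *)
Lemma direct_limit :
  exists (L : nmodType) (i : forall n, {additive M n -> L}),
    [/\ forall n, injective (i n),
        forall n x, i n.+1 (f n x) = i n x &
        forall y, exists n x, i n x = y].
Proof.
pose S (s : product_monoid M) := exists k, coherent_from k s.
have S0 : S 0 by exists 0 => n _; rewrite raddf0.
have SD s t : S s -> S t -> S (s + t).
  move=> [k cs] [l ct]; exists (maxn k l) => n; rewrite geq_max => /andP[kn ln].
  by rewrite !product_monoidD raddfD -cs // -ct.
have [F [j [j_inj jS]]] := submonoid_exists S0 SD.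
pose e (x y : F) := exists k, forall n, (k <= n)%N -> j x n = j y n.
have [||||L [pi [pi_surj pi_eq]]] := @congruence_quotient F e.
- by move=> x; exists 0.
- by move=> x y [k eq_k]; exists k => n /eq_k.
- move=> x y z [k exy] [l eyz]; exists (maxn k l) => n; rewrite geq_max => /andP[kn ln].
  by rewrite exy // eyz.
- by move=> x y z [k exy]; exists k => n kn; rewrite !raddfD !product_monoidD exy.
have thread_lift n (x : M n) : {y : F | j y = thread x}.
  by apply/cid/jS; exists n; apply: thread_coherent.
pose i n (x : M n) : L := pi (sval (thread_lift n x)).
(* Once both families are coherent, injectivity of the maps makes agreement at the single index [s]
   equivalent to eventual agreement. *)
have iP n (x : M n) y s k : coherent_from k (j y) -> (k <= s)%N -> (n <= s)%N ->
    i n x = pi y <-> thread x s = j y s.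
  move=> cy ks ns; rewrite pi_eq; have jx := svalP (thread_lift n x).
  split=> [[l]|eq_s].
    move=> /(_ (maxn l s) (leq_maxl _ _)); rewrite jx.
    apply: agree_down (leq_maxr l s) => m sm; last by apply: cy; apply: leq_trans sm.
    by apply: thread_coherent; apply: leq_trans sm.
  exists s => m sm; rewrite jx; apply: agree_up sm eq_s => l sl; last first.
    by apply: cy; apply: leq_trans sl.
  by apply: thread_coherent; apply: leq_trans sl.
have i_nmod n : nmod_morphism (i n).
  split=> [|x y]; rewrite /i.
    rewrite -(raddf0 pi); apply/(iP n 0 0 n 0); rewrite ?raddf0 ?thread_refl //.
    by move=> k _; rewrite raddf0.
  rewrite -raddfD; apply/(iP n _ _ n n) => //; last first.
    by rewrite raddfD !(svalP (thread_lift n _)) product_monoidD !thread_refl.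
  by move=> k nk; rewrite raddfD !(svalP (thread_lift n _)) !product_monoidD raddfD /= nk.
pose iA n := GRing.isNmodMorphism.Build (M n) L (i n) (i_nmod n).
exists L, (fun n => HB.pack_for {additive M n -> L} (i n) (iA n)); split=> /=.
- move=> n x y /iP; rewrite (svalP (thread_lift n y)) => /(_ n n).
  rewrite !thread_refl; apply=> //; exact: thread_coherent.
- move=> n x; apply/(iP n.+1 _ _ n.+1 n) => //; rewrite (svalP (thread_lift n x)).
    exact: thread_coherent.
  by rewrite thread_refl /= leqnn thread_refl.
- move=> y; have [x <-] := pi_surj y.
  have [k ck] : S (j x) by apply/jS; exists x.
  by exists k, (j x k); apply/(iP k _ _ k k); rewrite ?thread_refl.
Qed.
End DirectLimit.

(** * Words and their values *)

Section FinitelySupported.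
Variables (I : choiceType) (M : nmodType).

Let family := product_monoid (fun _ : I => M).

Definition finite_support : {pred family} :=
  fun g => `[< exists s : seq I, forall i, i \notin s -> g i = 0 >].

Let finite_support_closed : GRing.nmod_closed finite_support.
Proof.
split=> [|g h /asboolP[s gs] /asboolP[t ht]]; apply/asboolP; first by exists [::].
exists (s ++ t) => i; rewrite mem_cat negb_or => /andP[/gs gi /ht hi].
by rewrite product_monoidD gi hi addr0.
Qed.

Definition finsupp : Type := {g | finite_support g}.
HB.instance Definition _ := SubChoice.on finsupp.
HB.instance Definition _ :=
  GRing.SubChoice_isSubNmodule.Build family finite_support finsupp
    finite_support_closed.

Definition coef (g : finsupp) i : M := (\val g : family) i.

Lemma finsuppP (g h : finsupp) : coef g =1 coef h -> g = h.
Proof. by move=> gh; apply/val_inj/functional_extensionality_dep. Qed.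

Lemma coef0 i : coef 0 i = 0.
Proof. by []. Qed.

Lemma coefD g h i : coef (g + h) i = coef g i + coef h i.
Proof. by []. Qed.

Lemma coefMn g n i : coef (g *+ n) i = coef g i *+ n.
Proof. by elim: n => // n IH; rewrite !mulrS coefD IH. Qed.

Lemma finsupp_support (g : finsupp) :
  {s : seq I | uniq s /\ forall i, i \notin s -> coef g i = 0}.
Proof.
apply: cid; have /asboolP[s gs] := valP g.
by exists (undup s); split=> [|i]; rewrite ?undup_uniq // mem_undup; apply: gs.
Qed.

Lemma finsupp_of (f : I -> M) (s : seq I) :
  (forall i, i \notin s -> f i = 0) -> exists g, coef g =1 f.
Proof.
move=> fs; suff Sf : finite_support f by exists (exist _ (f : family) Sf).
by apply/asboolP; exists s.
Qed.

Definition total (g : finsupp) : M := \sum_(i <- sval (finsupp_support g)) coef g i.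

Lemma totalE (g : finsupp) (s : seq I) :
  uniq s -> (forall i, i \notin s -> coef g i = 0) -> total g = \sum_(i <- s) coef g i.
Proof.
rewrite /total; case: finsupp_support => t [tU tg] /= sU sg.
rewrite (bigID (mem s)) /= [X in _ + X]big1 ?addr0 => [|i /sg//].
rewrite [RHS](bigID (mem t)) /= [X in _ = _ + X]big1 ?addr0 => [|i /tg//].
rewrite -big_filter -[RHS]big_filter; apply/perm_big/uniq_perm; rewrite ?filter_uniq //.
by move=> i; rewrite !mem_filter andbC.
Qed.

Lemma total_is_nmod_morphism : nmod_morphism total.
Proof.
split=> [|g h]; first by rewrite (totalE (s := [::])) ?big_nil.
have [s [sU gs]] := finsupp_support g; have [t [tU ht]] := finsupp_support h.
have out i : i \notin undup (s ++ t) -> coef g i = 0 /\ coef h i = 0.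
  by rewrite mem_undup mem_cat negb_or => /andP[/gs ? /ht].
rewrite !(totalE (s := undup (s ++ t))) ?undup_uniq //.
- by rewrite -big_split.
- by move=> i /out[].
- by move=> i /out[].
- by move=> i /out[gi hi]; rewrite coefD gi hi addr0.
Qed.
HB.instance Definition _ := GRing.isNmodMorphism.Build finsupp M total total_is_nmod_morphism.

(** The remainder [m] is the sum of the other coefficients, hence lies in every submonoid containing
    all of them; conicality is applied to this splitting. *)
Lemma total_coef (g : finsupp) i : exists2 m,
  total g = coef g i + m & forall C : M -> Prop, C 0 ->
    (forall x y, C x -> C y -> C (x + y)) -> (forall j, C (coef g j)) -> C m.
Proof.
have [s [sU gs]] := finsupp_support g.
(* The index [i] is put into the list by hand, since it may lie outside the support. *)
have [t [tU [ti gt]]] : exists t : seq I,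
    uniq t /\ i \in t /\ forall j, j \notin t -> coef g j = 0.
  exists (undup (i :: s)); rewrite undup_uniq mem_undup mem_head; do 2!split=> //.
  by move=> j; rewrite mem_undup inE negb_or => /andP[_ /gs].
rewrite (totalE tU gt) (bigD1_seq i) //=; eexists; first by [].
by move=> C C0 CD Cg; elim/big_ind: _ => // j _.
Qed.

Lemma total_in (C : M -> Prop) (g : finsupp) : C 0 ->
  (forall x y, C x -> C y -> C (x + y)) -> (forall j, C (coef g j)) -> C (total g).
Proof. by move=> C0 CD Cg; elim/big_ind: (total g) => // j _. Qed.

Lemma single_exists i m : exists2 g, coef g i = m & forall j, j != i -> coef g j = 0.
Proof.
have [|g gE] := @finsupp_of (fun j => if j == i then m else 0) [:: i].
  by move=> j; rewrite inE => /negPf->.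
by exists g => [|j /negPf ji]; rewrite gE ?eqxx ?ji.
Qed.

Lemma total_single g i : (forall j, j != i -> coef g j = 0) -> total g = coef g i.
Proof. by move=> gi; rewrite (@totalE _ [:: i]) ?big_seq1 // => j; rewrite inE => /gi. Qed.
End FinitelySupported.

(* [V x m] says that the word [x] evaluates to [m]; words of nonzero degree have
   no value. *)
Record partial_valuation (W M : nmodType) (V : W -> M -> Prop) : Prop := {
  pval0 : V 0 0;
  pvalD : forall x y m n, V x m -> V y n -> V (x + y) (m + n);
  pval_fun : forall x m n, V x m -> V x n -> m = n;
  pval_cancel : forall x y m n, V x m -> V (x + y) n -> exists k, V y k;
  pval_compl : forall x, exists y m, V (x + y) m
}.

Lemma pvalMn (W M : nmodType) (V : W -> M -> Prop) x m n :
  partial_valuation V -> V x m -> V (x *+ n) (m *+ n).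
Proof.
move=> pV Vx; elim: n => [|n IH]; first exact: pval0.
by rewrite !mulrS; apply: pvalD.
Qed.

(** * Words with coordinatewise values *)

Section Words.
Variables (I : choiceType) (W M : nmodType) (R : I -> W -> M -> Prop).
Hypothesis pR : forall i, partial_valuation (R i).

(** The direct sum of [M] and of copies of [W] indexed by [I]: each index brings its own letters and
    its own grading. *)
Definition word : nmodType := (M * finsupp I W)%type.

Definition letters_val (g : finsupp I W) (k : M) : Prop :=
  exists2 h : finsupp I M, forall i, R i (coef g i) (coef h i) & k = total h.

Definition word_val (x : word) (k : M) : Prop :=
  exists2 n, letters_val x.2 n & k = x.1 + n.

Definition const_word (m : M) : word := (m, 0).

Lemma const_is_nmod_morphism : nmod_morphism const_word.
Proof. by split=> // m n; congr pair; rewrite addr0. Qed.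
HB.instance Definition _ := GRing.isNmodMorphism.Build M word const_word const_is_nmod_morphism.

Lemma word_const_val m : word_val (const_word m) m.
Proof.
exists 0; last by rewrite addr0.
by exists 0; [move=> i; exact: pval0 | rewrite raddf0].
Qed.

(** Coordinatewise values are automatically finitely supported, since the empty word has no value
    other than 0. *)
Lemma letters_val_supp (g : finsupp I W) (h : I -> M) : (forall i, R i (coef g i) (h i)) ->
  exists2 h' : finsupp I M, coef h' =1 h & letters_val g (total h').
Proof.
move=> gh; have [s [_ gs]] := finsupp_support g.
have [|h' hE] := @finsupp_of _ _ h s.
  by move=> i /gs gi; have := gh i; rewrite gi => Rh; apply: (pval_fun (pR i) Rh); exact: pval0.
by exists h' => //; exists h' => // i; rewrite hE.
Qed.

(** The complement consists of letters only: its constant part is 0, so it will count as positive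
    and yield cofinality. *)
Lemma word_compl (x : word) : exists g m, word_val (x + (0, g)) m.
Proof.
have [s [_ xs]] := finsupp_support x.2.
(* Outside the support the complement is chosen to be 0, which keeps it finitely supported. *)
have /choice[y Ry] i : exists y, (exists m, R i (coef x.2 i + y) m) /\
    (i \notin s -> y = 0).
  have [/xs->|is_] := boolP (i \notin s).
    by exists 0; split=> //; exists 0; rewrite addr0; exact: pval0.
  by have [y Vy] := pval_compl (pR i) (coef x.2 i); exists y.
have [g gE] := finsupp_of (fun i is_ => (Ry i).2 is_).
have /choice[h Rh] i : exists m, R i (coef (x.2 + g) i) m.
  by rewrite coefD gE; apply: (Ry i).1.
have [h' _ Vh] := letters_val_supp Rh.
by exists g, (x.1 + 0 + total h'); exists (total h').
Qed.

Lemma word_valuation : partial_valuation word_val.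
Proof.
have fun_val x m n : word_val x m -> word_val x n -> m = n.
  move=> [_ [h Rh ->] ->] [_ [h' Rh' ->] ->]; congr (_ + total _).
  by apply: finsuppP => i; apply: (pval_fun (pR i)).
split.
- exact: word_const_val.
- move=> x y _ _ [_ [h Rh ->] ->] [_ [h' Rh' ->] ->].
  exists (total h + total h'); last by rewrite addrACA.
  by exists (h + h') => [i|]; [rewrite !coefD; apply: (pvalD (pR i)) | rewrite raddfD].
- exact: fun_val.
- move=> x y _ _ [_ [h Rh _] _] [_ [h' Rh' _] _].
  have /choice[k Rk] i := pval_cancel (pR i) (Rh i) (Rh' i).
  have [k' _ Vk] := letters_val_supp Rk.
  by exists (y.1 + total k'); exists (total k').
- by move=> x; have [g [m Vm]] := word_compl x; exists (0, g), m.
Qed.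
End Words.

(** * The syntactic quotient *)

Section Syntactic.
Variables (F M : nmodType) (V : F -> M -> Prop) (j : {additive M -> F}).
Variable P : set nat.
Hypotheses (pV : partial_valuation V) (jV : forall m, V (j m) m).
Hypotheses (P_mul : multiplicative_subsemigroup P) (P1 : P 1%N).
Hypothesis tfM : torsion_free_for P M.

Definition same_contexts (x y : F) := forall t k, V (x + t) k <-> V (y + t) k.

(** The syntactic congruence of [V], saturated under division by [P]; the saturation is what makes
    the quotient [P]-torsion-free. *)
Definition torsion_congruent (x y : F) :=
  exists2 p, P p & same_contexts (x *+ p) (y *+ p).

Let sc_trans x y z : same_contexts x y -> same_contexts y z -> same_contexts x z.
Proof. by move=> xy yz t k; rewrite xy. Qed.

Let sc_add x y z : same_contexts x y -> same_contexts (x + z) (y + z).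
Proof. by move=> xy t k; rewrite -!addrA. Qed.

Let sc_mul x y n : same_contexts x y -> same_contexts (x *+ n) (y *+ n).
Proof.
move=> xy; elim: n => [|n IH] // t k; rewrite !mulrS.
by rewrite -addrA xy addrA [y + _]addrC -addrA IH addrA [_ + y]addrC.
Qed.

Let P_M p q : P p -> P q -> P (p * q)%N.
Proof. by case: P_mul => _ _ PM; apply: PM. Qed.

(** Transitivity multiplies the two exponents, and reflexivity uses the exponent 1. *)
Lemma syntactic_quotient : exists (N : nmodType) (pi : {additive F -> N}),
  (forall z, exists x, pi x = z) /\ forall x y, pi x = pi y <-> torsion_congruent x y.
Proof.
apply: congruence_quotient.
- by move=> x; exists 1%N.
- by move=> x y [p Pp xy]; exists p => // t k; rewrite xy.
- move=> x y z [p Pp xy] [q Pq yz]; exists (p * q)%N; first exact: P_M.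
  apply: (@sc_trans _ (y *+ (p * q))); first by rewrite !mulrnA; apply: sc_mul.
  by rewrite !(mulnC p) !mulrnA; apply: sc_mul.
- move=> x y z [p Pp xy]; exists p => //; rewrite !mulrnDl; exact: sc_add.
Qed.

Variables (N : nmodType) (pi : {additive F -> N}).
Hypotheses (pi_surj : forall z, exists x, pi x = z)
  (pi_eq : forall x y, pi x = pi y <-> torsion_congruent x y).

Lemma same_contexts_pi x y : same_contexts x y -> pi x = pi y.
Proof. by move=> xy; apply/pi_eq; exists 1%N. Qed.

(** If [y] and [y + t] have values, then so does [t], by [pval_cancel]; hence in every context a
    word with a value behaves like the constant of that value. *)
Lemma pi_val x k : V x k -> pi x = pi (j k).
Proof.
suff val_ctx y z t l : V y k -> V z k -> V (y + t) l -> V (z + t) l.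
  by move=> Vx; apply: same_contexts_pi => t l; split; apply: val_ctx.
move=> Vy Vz Vt; have [n Vn] := pval_cancel pV Vy Vt.
by rewrite (pval_fun pV Vt (pvalD pV Vy Vn)); apply: pvalD.
Qed.

(** The congruence is tested in the empty context, where the constant side has the value
    [m *+ p]. *)
Lemma val_of_pi x m : pi x = pi (j m) -> exists2 p, P p & V (x *+ p) (m *+ p).
Proof.
move=> /pi_eq[p Pp xm]; exists p => //; have := xm 0 (m *+ p).
by rewrite !addr0 => ->; rewrite -raddfMn; apply: jV.
Qed.

Lemma pi_const_inj : injective (pi \o j).
Proof.
move=> m n /= /val_of_pi[p Pp Vp]; apply: (tfM Pp).
by apply: (pval_fun pV _ Vp); rewrite -raddfMn; apply: jV.
Qed.

Lemma syntactic_torsion_free : torsion_free_for P N.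
Proof.
move=> p Pp z w; have [x <-] := pi_surj z; have [y <-] := pi_surj w.
rewrite -!raddfMn => /pi_eq[q Pq xy]; apply/pi_eq.
by exists (p * q)%N; rewrite ?mulrnA //; apply: P_M.
Qed.

(** Cancelling the constant [m *+ p] leaves a value for [x *+ p]. This is the source of unitarity
    and of the reflection of the order. *)
Lemma val_of_difference x m n : pi (j m) + pi x = pi (j n) ->
  exists p k, [/\ P p, V (x *+ p) k & m *+ p + k = n *+ p].
Proof.
rewrite -raddfD => /val_of_pi[p Pp Vp].
rewrite mulrnDl in Vp.
have Vm : V (j m *+ p) (m *+ p) by rewrite -raddfMn; apply: jV.
have [k Vk] := pval_cancel pV Vm Vp.
by exists p, k; split=> //; apply: (pval_fun pV _ Vp); apply: pvalD.
Qed.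

End Syntactic.

(** * Adjoining refinements *)

(** [C] is all of [M] when [M] is a cone, and the positive cone when [M] is an ordered group. *)
Definition conical_submonoid (M : nmodType) (C : M -> Prop) : Prop :=
  [/\ C 0, forall x y, C x -> C y -> C (x + y) &
      forall x y, C x -> C y -> x + y = 0 -> x = 0].

Lemma conical_submonoidMn (M : nmodType) (C : M -> Prop) x n :
  conical_submonoid C -> C x -> C (x *+ n).
Proof. by move=> [C0 CD _] Cx; elim: n => [|n IH] //; rewrite mulrS; apply: CD. Qed.

Lemma conical_mulrn_eq0 (M : nmodType) (C : M -> Prop) x n :
  conical_submonoid C -> C x -> x *+ n = 0 -> x = 0 \/ n = 0%N.
Proof.
move=> CC Cx; case: n => [|n]; [by right | rewrite mulrS => eq0; left].
by case: (CC) => _ _ /(_ x (x *+ n)); apply=> //; apply: conical_submonoidMn.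
Qed.

(** [P] governs the torsion of [M] and [U] the division of positive elements: [U] will be {1} for
    (b) and [P] with 1 adjoined for (d). *)
Definition admissible_cone (P U : set nat) (M : nmodType) (C : M -> Prop) : Prop :=
  [/\ conical_submonoid C, torsion_free_for P M &
      forall u, U u -> forall x, C (x *+ u) -> C x].

(* The order [x <= y] is the existence of a positive [c] with [x + c = y]. *)
Definition unitary_extension (M N : nmodType) (C : M -> Prop) (D : N -> Prop)
    (f : M -> N) : Prop :=
  [/\ injective f,
      forall x, C x <-> D (f x),
      forall b, exists a c, D c /\ b + c = f a,
      forall a0 a1 b, f a0 + b = f a1 -> exists a, b = f a &
      forall m a b, (0 < m)%N -> b *+ m = f a -> exists a', b = f a'].

(** Equations in the source are refined in the target; for [f = id] and [C = D] this is the
    refinement property of [D]. *)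
Definition refines (M N : nmodType) (C : M -> Prop) (D : N -> Prop)
    (f : M -> N) : Prop :=
  forall a0 a1 b0 b1, C a0 -> C a1 -> C b0 -> C b1 -> a0 + a1 = b0 + b1 ->
  exists c00 c01 c10 c11, [/\ D c00, D c01, D c10 & D c11] /\
    [/\ f a0 = c00 + c01, f a1 = c10 + c11, f b0 = c00 + c10 & f b1 = c01 + c11].

Section RefinementLetters.
Variables (M : nmodType) (C : M -> Prop).

Let W : nmodType := ((nat * nat) * (nat * nat))%type.

(* The word [(n00, n01, n10, n11)] stands for [\sum_ij c_ij *+ n_ij]; it is
   evaluated by grouping its letters into pairs with sum [a0], [b0], [b1], [a1]. *)
Definition refinement_val (r : M * M * M * M) (x : W) (m : M) : Prop :=
  let: (a0, a1, b0, b1) := r in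
  exists al be ga de : nat,
    x = ((al + be, al + ga), (be + de, ga + de))%N /\
    m = a0 *+ al + b0 *+ be + (b1 *+ ga + a1 *+ de).

Lemma refinement_val_exists r (x : W) : (exists m, refinement_val r x m) <->
  (x.1.1 + x.2.2 = x.1.2 + x.2.1)%N.
Proof.
case: r => [[[a0 a1] b0] b1]; case: x => [[n00 n01] [n10 n11]] /=; split.
  by move=> [_ [al [be [ga [de [[-> -> -> ->] _]]]]]]; lia.
(* Pair as many c00 with c01 as possible; a surplus of c00 is paired with c10, a surplus of c01 with
   c11, and the remaining c10 and c11 with each other. *)
move=> eq_n; eexists; exists (minn n00 n01), (n00 - n01)%N, (n01 - n00)%N.
exists (n10 - (n00 - n01))%N; split; last by [].
by congr ((_, _), (_, _)); lia.
Qed.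

(** Requiring nonzero terms makes the empty word the only one of value 0; equations with a zero term
    have obvious refinements. *)
Definition refinable (r : M * M * M * M) : Prop :=
  let: (a0, a1, b0, b1) := r in
  [/\ a0 + a1 = b0 + b1, C a0 /\ C a1, C b0 /\ C b1 &
      (a0 <> 0 /\ a1 <> 0) /\ (b0 <> 0 /\ b1 <> 0)].

Let addW (x y : W) : x + y = ((x.1.1 + y.1.1, x.1.2 + y.1.2), (x.2.1 + y.2.1, x.2.2 + y.2.2))%N.
Proof. by []. Qed.

(** Two pairings of one word differ by trading [k] copies of [a0] and [a1] for [k] copies of [b0]
    and [b1], which does not change the value. *)
Lemma refinement_valuation r : refinable r -> partial_valuation (refinement_val r).
Proof.
case: r => [[[a0 a1] b0] b1] [eq_ab _ _ _].
split.
- by exists 0%N, 0%N, 0%N, 0%N; rewrite !mulr0n !addr0.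
- move=> x y m n [al [be [ga [de [-> ->]]]]] [al' [be' [ga' [de' [-> ->]]]]].
  exists (al + al')%N, (be + be')%N, (ga + ga')%N, (de + de')%N.
  split; first by rewrite addW /=; congr ((_, _), (_, _)); lia.
  by rewrite !mulrnDr addrACA [X in X + _]addrACA [X in _ + X]addrACA.
- move=> x m n [al [be [ga [de [-> ->]]]]] [al' [be' [ga' [de' [[e1 e2 e3 e4] ->]]]]].
  wlog le_al : al be ga de al' be' ga' de' e1 e2 e3 e4 / (al <= al')%N.
    move=> H; have [le_al|/ltnW le_al] := leqP al al'; first exact: H.
    by apply/esym/H.
  have [k ek] : {k | al' = al + k}%N by exists (al' - al)%N; lia.
  have -> : be = (be' + k)%N by lia.
  have -> : ga = (ga' + k)%N by lia.
  have -> : de' = (de + k)%N by lia.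
  rewrite ek !mulrnDr.
  (* Collect the [k]-fold terms at the end: those of [b0] and [b1] on the left, those of [a0] and
     [a1] on the right. *)
  rewrite [LHS](AC ((1*2)*(2*1)) (((1*2)*(4*6))*(3*5)))/=.
  rewrite [RHS](AC ((2*1)*(1*2)) (((1*3)*(4*5))*(2*6)))/=.
  by rewrite -!mulrnDl eq_ab.
- move=> x y m n Vx Vxy; apply/refinement_val_exists.
  have /refinement_val_exists : exists m, refinement_val (a0, a1, b0, b1) x m by exists m.
  have /refinement_val_exists : exists m, refinement_val (a0, a1, b0, b1) (x + y) m by exists n.
  by rewrite addW /=; lia.
(* Exchanging c00 with c01 and c10 with c11 negates the degree. *)
- move=> x; exists ((x.1.2, x.1.1), (x.2.2, x.2.1)).
  by apply/refinement_val_exists; rewrite addW /=; lia.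
Qed.
End RefinementLetters.

Section RefinementLettersPositive.
Variables (M : nmodType) (C : M -> Prop).
Hypothesis CC : conical_submonoid C.
Let W : nmodType := ((nat * nat) * (nat * nat))%type.

(** Degrees are integers, so a word has degree 0 as soon as a positive multiple of it does. *)
Lemma refinement_val_saturated (r : M * M * M * M) (x : W) p k : (0 < p)%N ->
  refinement_val r (x *+ p) k -> exists m, refinement_val r x m.
Proof.
move=> p0 Vx; apply/refinement_val_exists.
have /refinement_val_exists : exists m, refinement_val r (x *+ p) m by exists k.
have -> : x *+ p = ((x.1.1 * p, x.1.2 * p), (x.2.1 * p, x.2.2 * p))%N.
  elim: p {p0 Vx} => [|p IH]; first by rewrite !muln0.
  by rewrite mulrS IH; congr ((_, _), (_, _)); rewrite /= mulnS.
by rewrite /=; nia.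
Qed.

Lemma refinement_val_pos r (x : W) m : refinable C r -> refinement_val r x m -> C m.
Proof.
case: r => [[[a0 a1] b0] b1] [_ [? ?] [? ?] _] [al [be [ga [de [_ ->]]]]].
by case: (CC) => _ CD _; apply: (CD); apply: (CD); apply: conical_submonoidMn.
Qed.

(** A sum of multiples of nonzero positive elements vanishes only if all four multiplicities do. *)
Lemma refinement_val_conical r (x : W) :
  refinable C r -> refinement_val r x 0 -> x = 0.
Proof.
case: r => [[[a0 a1] b0] b1] [_ [Ca0 Ca1] [Cb0 Cb1] [[a0N a1N] [b0N b1N]]].
move=> [al [be [ga [de [-> eq0]]]]].
have CM y n : C y -> C (y *+ n) by apply: conical_submonoidMn.
case: (CC) => _ CD CK.
have split0 y z : C y -> C z -> 0 = y + z -> 0 = y /\ 0 = z.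
  move=> Cy Cz /esym yz; have y0 := CK _ _ Cy Cz yz.
  by rewrite addrC in yz; rewrite y0 (CK _ _ Cz Cy yz).
have [] := split0 _ _ _ _ eq0; try by apply: CD; apply: CM.
move=> /split0[||/esym ea /esym eb]; try exact: CM.
move=> /split0[||/esym ec /esym ed]; try exact: CM.
have [//|->] := conical_mulrn_eq0 CC Ca0 ea.
have [//|->] := conical_mulrn_eq0 CC Cb0 eb.
have [//|->] := conical_mulrn_eq0 CC Cb1 ec.
by have [//|->] := conical_mulrn_eq0 CC Ca1 ed.
Qed.
End RefinementLettersPositive.

(** * Positivity and conicality of words *)

Section PositiveWords.
Variables (I : choiceType) (W M : nmodType) (R : I -> W -> M -> Prop) (C : M -> Prop).
Hypotheses (pR : forall i, partial_valuation (R i)) (CC : conical_submonoid C).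
Hypothesis R_pos : forall i x m, R i x m -> C m.
Hypothesis R_conical : forall i x, R i x 0 -> x = 0.

Lemma letters_val_pos g k : letters_val R g k -> C k.
Proof.
case: (CC) => C0 CD _ [h Rh ->]; apply: total_in => // i; exact: R_pos (Rh i).
Qed.

Lemma letters_val_conical g : letters_val R g 0 -> g = 0.
Proof.
move=> [h Rh h0]; apply: finsuppP => i; rewrite coef0; apply: (@R_conical i).
have [m eq_m Cm] := total_coef h i; case: (CC) => C0 CD CK.
suff hi0 : coef h i = 0 by rewrite -hi0; apply: Rh.
apply: (CK _ m); [exact: R_pos (Rh i) | | by rewrite h0 eq_m].
by apply: Cm => // j; apply: R_pos (Rh j).
Qed.

Lemma word_val_pos x k : C x.1 -> word_val R x k -> C k.
Proof. by case: (CC) => _ CD _ Cx [n /letters_val_pos Cn ->]; apply: CD. Qed.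

Lemma word_val_conical x : C x.1 -> word_val R x 0 -> x = 0.
Proof.
case: (CC) => _ _ CK Cx [n Vn /esym eq0]; have Cn := letters_val_pos Vn.
have x0 := CK _ _ Cx Cn eq0; rewrite addrC in eq0; have n0 := CK _ _ Cn Cx eq0.
rewrite n0 in Vn; rewrite [x]surjective_pairing x0.
by have := letters_val_conical Vn; rewrite /= => ->.
Qed.

Lemma positive_words_conical : (forall v w : W, v + w = 0 -> v = 0) ->
  conical_submonoid (fun x : word I W M => C x.1).
Proof.
case: (CC) => C0 CD CK WK; split=> [|x y|x y Cx Cy xy0] //; first exact: CD.
have [xy1 xy2] : x.1 + y.1 = 0 /\ x.2 + y.2 = 0
  by split; [have := congr1 fst xy0 | have := congr1 snd xy0].
rewrite [x]surjective_pairing (CK _ _ Cx Cy xy1); congr pair.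
by apply: finsuppP => i; apply: (WK _ (coef y.2 i)); rewrite -coefD xy2.
Qed.
End PositiveWords.

Section WordsLetters.
Variables (I : choiceType) (W M : nmodType) (R : I -> W -> M -> Prop).
Hypothesis pR : forall i, partial_valuation (R i).

Lemma word_val_saturated x p k :
  (forall i x k, R i (x *+ p) k -> exists m, R i x m) ->
  word_val R (x *+ p) k -> exists m, word_val R x m.
Proof.
move=> satR [_ [h Rh _] _].
have snd_Mn : (x *+ p).2 = x.2 *+ p by elim: p {satR h Rh} => // p IH; rewrite !mulrS /= -IH.
have /choice[h' Rh'] i : exists m, R i (coef x.2 i) m.
  by apply: (satR i _ (coef h i)); rewrite -coefMn -snd_Mn.
have [h'' _ Vh] := letters_val_supp pR Rh'.
by exists (x.1 + total h''), (total h'').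
Qed.

Lemma letter_exists i : exists l : {additive W -> word I W M},
  [/\ forall w, (l w).1 = 0, forall w, coef (l w).2 i = w &
      forall w m, R i w m -> word_val R (l w) m].
Proof.
have /choice[s sP] w : exists g : finsupp I W,
    coef g i = w /\ forall j, j != i -> coef g j = 0.
  by have [g] := single_exists i w; exists g.
pose l w : word I W M := (0, s w).
have l_nmod : nmod_morphism l.
  split=> [|v w]; apply: (congr2 pair); rewrite /= ?addr0 //; apply: finsuppP => j.
    by have [->|/(sP _).2->] := eqVneq j i; rewrite ?(sP _).1.
  have [->|ji] := eqVneq j i; first by rewrite coefD !(sP _).1.
  by rewrite coefD !(sP _).2 // addr0.
pose lA := GRing.isNmodMorphism.Build W (word I W M) l l_nmod.
exists (HB.pack_for {additive W -> word I W M} l lA); split=> //= [w|w m Rm].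
  exact: (sP w).1.
exists m; last by rewrite add0r.
have [h hi hj] := single_exists i m; exists h; last by rewrite (total_single hj) hi.
move=> j; have [->|ji] := eqVneq j i; first by rewrite hi /= (sP w).1.
by rewrite hj // (sP w).2 //; exact: pval0.
Qed.
End WordsLetters.

(** * One refinement step, with its positive elements *)

Section Steps.
Variables (P U : set nat).
Hypotheses (P_mul : multiplicative_subsemigroup P) (P1 : P 1%N).
Hypotheses (U_mul : multiplicative_subsemigroup U) (U1 : U 1%N) (U_P : forall u, U u -> P u).

Let P_gt0 p : P p -> (0 < p)%N.
Proof. by case: P_mul => PN _ _ /PN. Qed.

Let U_M u v : U u -> U v -> U (u * v)%N.
Proof. by case: U_mul => _ _; apply. Qed.

Lemma refinement_step (M : nmodType) (C : M -> Prop) : admissible_cone P U C ->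
  exists (N : nmodType) (D : N -> Prop) (f : {additive M -> N}),
    [/\ admissible_cone P U D, unitary_extension C D f, refines C D f &
        (forall x, C x) -> forall z, D z].
Proof.
move=> [CC tfM unpC].
pose I : choiceType := {r : M * M * M * M | `[< refinable C r >]}.
pose W : nmodType := ((nat * nat) * (nat * nat))%type.
pose R (i : I) : W -> M -> Prop := refinement_val (val i).
have iC (i : I) : refinable C (val i) by apply/asboolP/(valP i).
have pR i : partial_valuation (R i) by apply: refinement_valuation (iC i).
have R_pos i x m : R i x m -> C m by apply: refinement_val_pos CC _ _ _ (iC i).
have R_con i x : R i x 0 -> x = 0 by apply: refinement_val_conical CC _ _ (iC i).
have pV := word_valuation pR.
pose j : {additive M -> word I W M} := @const_word I W M.
have jV : forall m, word_val R (j m) m := word_const_val pR.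
have V_sat x p k : (0 < p)%N -> word_val R (x *+ p) k -> exists m, word_val R x m.
  move=> p0; apply: (word_val_saturated pR) => i y l.
  by apply: refinement_val_saturated.
have [N [pi [pi_surj pi_eq]]] := syntactic_quotient (word_val R) P_mul P1.
pose f : {additive M -> N} := pi \o j.
have f_val x m : word_val R x m -> pi x = f m := pi_val pV jV P1 pi_eq (k := m).
have pi_f x m := val_of_pi jV pi_eq (x := x) (m := m).
(* Positive are the classes of words with constant part in [C], and whatever becomes such a class
   after multiplication by an element of [U]. *)
pose D z := exists u x, [/\ U u, C x.1 & z *+ u = pi x].
have val_D x m : word_val R x m -> C x.1 -> C m by move=> Vx Cx; apply: word_val_pos Vx.
have tfN := syntactic_torsion_free P_mul pi_surj pi_eq.
have pi_D x : C x.1 -> D (pi x) by move=> Cx; exists 1%N, x.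
have word_Mn1 (x : word I W M) n : (x *+ n).1 = x.1 *+ n.
  by elim: n => // n IH; rewrite !mulrS /= IH.
have CW : conical_submonoid (fun x : word I W M => C x.1).
  apply: (@positive_words_conical I W M C CC) => -[[? ?] [? ?]] [[? ?] [? ?]].
  by move=> [/eqP + /eqP + /eqP + /eqP]; do 4!(rewrite addn_eq0 => /andP[/eqP-> _]).
case: (CW) => W0 WD WK.
exists N, D, f; split; first split=> //.
- split.
  + by rewrite -(raddf0 pi); apply: pi_D.
  + move=> z w [u [x [Uu Cx zx]]] [v [y [Uv Cy wy]]].
    exists (u * v)%N, (x *+ v + y *+ u); split; first exact: U_M.
      by apply: (WD); apply: (conical_submonoidMn _ CW).
    by rewrite mulrnDl mulrnA zx (mulnC u) mulrnA wy -!raddfMn -raddfD.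
  + move=> z w [u [x [Uu Cx zx]]] [v [y [Uv Cy wy]]] zw0.
    (* This word represents the multiple [(z + w) *+ (u * v)], so conicality of words applies to
       it. *)
    have : pi (x *+ v + y *+ u) = pi (j 0).
      rewrite !raddf0 raddfD !raddfMn -zx -wy -!mulrnA (mulnC v) -mulrnDl zw0.
      by rewrite mul0rn.
    have Cxv : C (x *+ v).1 by apply: (conical_submonoidMn _ CW).
    have Cyu : C (y *+ u).1 by apply: (conical_submonoidMn _ CW).
    have Cxy := WD _ _ Cxv Cyu.
    move=> /pi_f[p Pp]; rewrite mul0rn => Vp.
    have /(conical_mulrn_eq0 CW Cxy)[|p0] : (x *+ v + y *+ u) *+ p = 0.
    * by apply: (word_val_conical CC R_pos R_con) Vp; apply: (conical_submonoidMn _ CW).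
    * move=> /(WK _ _ Cxv Cyu)/(conical_mulrn_eq0 CW Cx)[x0|v0].
        by apply: (tfN u (U_P Uu)); rewrite zx x0 raddf0 mul0rn.
      by have := P_gt0 (U_P Uv); rewrite v0.
    * by have := P_gt0 Pp; rewrite p0.
- move=> u Uu z [v [x [Uv Cx zx]]]; exists (u * v)%N, x; split=> //; first exact: U_M.
  by rewrite mulrnA.
- split.
  + exact: (pi_const_inj pV jV tfM pi_eq).
  + move=> m; split=> [Cm|[u [x [Uu Cx]]]]; first exact: pi_D.
    (* Saturation gives [x] itself a value [k] in [C]; torsion-freeness of [M] identifies it with
       [m *+ u], and then [C] is divided by [u]. *)
    rewrite -raddfMn => /esym/pi_f[p Pp Vp].
    have [k Vk] := V_sat _ _ _ (P_gt0 Pp) Vp.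
    apply: (unpC u Uu); suff -> : m *+ u = k by apply: val_D Vk Cx.
    by apply: (tfM p Pp); apply: (pval_fun pV Vp); apply: pvalMn.
  + move=> z; have [x <-] := pi_surj z.
    have [g [m Vxg]] := word_compl pR x.
    exists m, (pi (0, g)); split; first exact: pi_D.
    by rewrite -raddfD; exact: f_val Vxg.
  + move=> a0 a1 z; have [x <-] := pi_surj z.
    move=> /(val_of_difference pV jV pi_eq)[p [k [Pp Vp _]]].
    have [m Vm] := V_sat _ _ _ (P_gt0 Pp) Vp.
    by exists m; exact: f_val Vm.
  (* A positive multiple of [x] has a value, so [x] has one too and its class comes from [M]. *)
  + move=> n a z n0; have [x <-] := pi_surj z.
    rewrite -raddfMn => /pi_f[p Pp]; rewrite -mulrnA => Vx.
    have [|m Vm] := V_sat _ _ _ _ Vx; first by rewrite muln_gt0 n0 P_gt0.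
    by exists m; exact: f_val Vm.
- move=> a0 a1 b0 b1 Ca0 Ca1 Cb0 Cb1 eq_ab.
  have D0 : D 0 by rewrite -(raddf0 pi); apply: pi_D.
  have fD a : C a -> D (f a) by move=> Ca; exact: (pi_D (j a)).
  (* No letters were adjoined for equations with a zero term; they are refined by their own terms
     and zeros. *)
  have [a00|a0N] := pselect (a0 = 0).
    exists 0, 0, (f b0), (f b1); rewrite -[in f b0 + f b1]raddfD -eq_ab a00 !add0r raddf0.
    by do !split=> //; apply: fD.
  have [a10|a1N] := pselect (a1 = 0).
    exists (f b0), (f b1), 0, 0; rewrite -[in f b0 + f b1]raddfD -eq_ab a10 !addr0 raddf0.
    by do !split=> //; apply: fD.
  have [b00|b0N] := pselect (b0 = 0).
    exists 0, (f a0), 0, (f a1); rewrite -[in f a0 + f a1]raddfD eq_ab b00 !add0r raddf0.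
    by do !split=> //; apply: fD.
  have [b10|b1N] := pselect (b1 = 0).
    exists (f a0), 0, (f a1), 0; rewrite -[in f a0 + f a1]raddfD eq_ab b10 !addr0 raddf0.
    by do !split=> //; apply: fD.
  have Ci : refinable C (a0, a1, b0, b1) by do !split.
  pose i : I := exist _ (a0, a1, b0, b1) (asboolT Ci).
  have [l [l1 _ lV]] := letter_exists pR i.
  have Dl w : D (pi (l w)) by apply: pi_D; rewrite l1.
  (* The refinement is given by the letters themselves, since each relevant pair of letters has the
     required value. *)
  have sumE v w m : R i (v + w) m -> f m = pi (l v) + pi (l w).
    by move=> /lV Vm; rewrite -!raddfD (f_val _ _ Vm).
  exists (pi (l ((1, 0), (0, 0))%N)), (pi (l ((0, 1), (0, 0))%N)).
  exists (pi (l ((0, 0), (1, 0))%N)), (pi (l ((0, 0), (0, 1))%N)).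
  split; first by split.
  split; apply: sumE.
  + by exists 1%N, 0%N, 0%N, 0%N; rewrite !mulr0n !addr0.
  + by exists 0%N, 0%N, 0%N, 1%N; rewrite !mulr0n !add0r.
  + by exists 0%N, 1%N, 0%N, 0%N; rewrite !mulr0n !addr0 add0r.
  + by exists 0%N, 0%N, 1%N, 0%N; rewrite !mulr0n !addr0 add0r.
- by move=> CT z; have [x <-] := pi_surj z; apply: pi_D.
Qed.
End Steps.

(** * Adjoining divided elements *)

(** For [r = (p, a)], the number [x] counts copies of the adjoined [u], and each block of [p] copies
    is worth [a]. *)
Definition division_val (M : nmodType) (r : nat * M) (x : nat) (m : M) : Prop :=
  exists k, x = (k * r.1)%N /\ m = r.2 *+ k.

Lemma division_valuation (M : nmodType) (r : nat * M) :
  (0 < r.1)%N -> partial_valuation (division_val r).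
Proof.
move=> p0; split.
- by exists 0%N.
- move=> x y m n [k [-> ->]] [l [-> ->]]; exists (k + l)%N.
  by rewrite mulnDl mulrnDr.
- move=> x m n [k [-> ->]] [l [/eqP + ->]].
  by rewrite eqn_pmul2r // => /eqP->.
- move=> x y m n [k [-> _]] [l [eq_l _]]; exists (r.2 *+ (l - k)), (l - k)%N.
  by rewrite mulnBl -eq_l addKn.
(* Adding [p - 1] further copies for each of the [x] copies gives [x] full blocks. *)
- move=> x; exists (x * r.1.-1)%N, (r.2 *+ x), x; split=> //.
  by rewrite -[RHS](congr1 (muln x) (prednK p0)) mulnS.
Qed.

(** Degrees now lie in finite cyclic groups, so a multiple of a word may have a value when the word
    has none; hence the order is reflected only up to a factor in [P]. *)
Lemma division_step (P : set nat) (M : nmodType) :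
  multiplicative_subsemigroup P -> P 1%N -> cone M -> torsion_free_for P M ->
  exists (N : nmodType) (f : {additive M -> N}),
    [/\ cone N, torsion_free_for P N, injective f,
        forall x y, alg_le (f x) (f y) -> exists2 p, P p & alg_le (x *+ p) (y *+ p) &
        forall p a, (0 < p)%N -> exists2 u, u *+ p = f a &
          forall x y, x + a = y + a -> f x + u = f y + u].
Proof.
move=> P_mul P1 coneM tfM.
have P_gt0 p : P p -> (0 < p)%N by case: P_mul => PN _ _ /PN.
have CC : conical_submonoid (fun _ : M => True) by split=> // x y _ _ /coneM[].
(* Only nonzero elements are divided, which keeps the words conical; 0 is divided by 0 itself
   below. *)
pose I : choiceType := {r : nat * M | (0 < r.1)%N && (r.2 != 0)}.
pose R (i : I) : nat -> M -> Prop := division_val (val i).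
have pR i : partial_valuation (R i) by apply: division_valuation; case/andP: (valP i).
have R_con i x : R i x 0 -> x = 0.
  move=> [k [-> /esym/(conical_mulrn_eq0 CC)[//|a0|->//]]].
  by have /andP[_] := valP i; rewrite a0 eqxx.
have pV := word_valuation pR.
pose j : {additive M -> word I nat M} := @const_word I nat M.
have jV : forall m, word_val R (j m) m := word_const_val pR.
have [N [pi [pi_surj pi_eq]]] := syntactic_quotient (word_val R) P_mul P1.
pose f : {additive M -> N} := pi \o j.
have f_val x m : word_val R x m -> pi x = f m := pi_val pV jV P1 pi_eq (k := m).
have [_ _ WK] : conical_submonoid (fun x : word I nat M => True).
  apply: (@positive_words_conical I nat M _ CC) => v w /eqP.
  by rewrite addn_eq0 => /andP[/eqP].
have pi_f x m := val_of_pi jV pi_eq (x := x) (m := m).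
have CW : conical_submonoid (fun x : word I nat M => True) by [].
have cone0 x y : pi x + pi y = 0 -> x = 0.
  rewrite -raddfD -(raddf0 (pi \o j)) => /pi_f[p Pp]; rewrite mul0rn.
  move=> /(word_val_conical CC (fun _ _ _ _ => Logic.I) R_con Logic.I).
  move=> /(conical_mulrn_eq0 CW Logic.I)[/WK->//|p0].
  by have := P_gt0 p Pp; rewrite p0.
exists N, f; split.
- move=> z w; have [x <-] := pi_surj z; have [y <-] := pi_surj w => xy0.
  by rewrite (cone0 x y xy0) (cone0 y x) ?raddf0 // addrC.
- exact: (syntactic_torsion_free P_mul pi_surj pi_eq).
- exact: (pi_const_inj pV jV tfM pi_eq).
- move=> m n [z]; have [x <-] := pi_surj z.
  by move=> /(val_of_difference pV jV pi_eq)[p [k [Pp _ eq_k]]]; exists p => //; exists k.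
move=> p a p0; have [->|a0] := eqVneq a 0.
  by exists 0 => [|x y]; rewrite ?mul0rn ?raddf0 // !addr0 => ->.
have ri : (0 < (p, a).1)%N && ((p, a).2 != 0) by rewrite /= p0.
pose i : I := exist _ (p, a) ri.
have [l [l1 li lV]] := letter_exists pR i.
(* A word containing [u] and having a value contains at least one block of [p] copies, so its value
   has a summand [a], which absorbs the difference of [x] and [y]. *)
have swap x y t k : x + a = y + a ->
    word_val R (j x + l 1%N + t) k -> word_val R (j y + l 1%N + t) k.
  move=> xya [_ [h Rh ->] ->]; exists (total h); first by exists h.
  have [m -> _] := total_coef h i.
  have [q [eq_q ->]] := Rh i; rewrite !coefD li coef0 /= in eq_q.
  case: q eq_q => [|q] _ //; rewrite mulrS /= !l1 !addr0.
  by rewrite -(addrA a) addrACA xya [RHS]addrACA.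
exists (pi (l 1%N)) => [|x y xya].
  have one_p : 1%N *+ p = p by elim: (p) => // q IH; rewrite mulrS IH.
  by rewrite -!raddfMn one_p; apply/f_val/lV; exists 1%N; rewrite mul1n.
rewrite /f /= -!raddfD; apply: (same_contexts_pi P1 pi_eq) => t k.
by split; apply: swap.
Qed.

(** * Iteration *)

(** Every stage carries its map from the fixed [A], so that invariants compare it with [A]
    directly. *)
Record extension (A : nmodType) := Extension {
  ext_car :> nmodType;
  ext_pos : ext_car -> Prop;
  ext_emb : {additive A -> ext_car}
}.

Section Chain.
Variables (A : nmodType) (Inv : extension A -> Prop).
Variable Step : forall X Y : extension A, (X -> Y) -> Prop.

Definition good_step (X Y : extension A) (h : {additive X -> Y}) : Prop :=
  [/\ injective h, forall a, h (ext_emb X a) = ext_emb Y a,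
      forall x, ext_pos x -> ext_pos (h x) & Step h].

Hypothesis next_exists : forall X, Inv X ->
  exists (Y : extension A) (h : {additive X -> Y}), Inv Y /\ good_step h.

Variable X0 : extension A.
Hypothesis X0_inv : Inv X0.

Lemma chain_exists : exists X : nat -> extension A,
  forall n, Inv (X n) /\ exists h : {additive X n -> X n.+1}, good_step h.
Proof.
(* Packing the invariant with the stage turns dependent choice into iteration of a function. *)
have next (X : {X | Inv X}) : {Y : {Y | Inv Y} |
    exists h : {additive sval X -> sval Y}, good_step h}.
  apply: cid; have [Y [h [InvY hP]]] := next_exists (svalP X).
  by exists (exist _ Y InvY), h.
pose X n := iter n (fun X => sval (next X)) (exist _ X0 X0_inv).
exists (fun n => sval (X n)) => n; split; first exact: svalP.
exact: svalP (next (X n)).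
Qed.

Lemma chain_limit :
  exists (L : nmodType) (X : nat -> extension A) (i : forall n, {additive X n -> L}),
    [/\ forall n, Inv (X n), forall n, injective (i n),
        forall n a, i n (ext_emb (X n) a) = i 0%N (ext_emb (X 0%N) a),
        forall y, exists n x, i n x = y &
        forall n, exists h : {additive X n -> X n.+1},
          (forall x, i n.+1 (h x) = i n x) /\ good_step h].
Proof.
have [X XP] := chain_exists.
pose h n := sval (cid (XP n).2); have hP n : good_step (h n) := svalP (cid (XP n).2).
have h_inj n : injective (h n) by case: (hP n).
have [L [i [i_inj ih i_surj]]] := direct_limit h_inj.
exists L, X, i; split=> //.
- by move=> n; case: (XP n).
- move=> n a; elim: n => // n <-.
  by have [_ <- _ _] := hP n; rewrite ih.
- by move=> n; exists (h n); split.
Qed.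
End Chain.

Section Limit.
Variable A : nmodType.
Variable Step : forall X Y : extension A, (X -> Y) -> Prop.
Variables (L : nmodType) (X : nat -> extension A) (i : forall n, {additive X n -> L}).
Hypothesis i_surj : forall y, exists n x, i n x = y.
Hypothesis i_step : forall n, exists h : {additive X n -> X n.+1},
  (forall x, i n.+1 (h x) = i n x) /\ good_step Step h.

Definition limit_pos y := exists n x, ext_pos x /\ i n x = y.

Lemma limit_lift n m (x : X n) : (n <= m)%N ->
  exists x' : X m, i m x' = i n x /\ (ext_pos x -> ext_pos x').
Proof.
elim: m => [|m IH]; first by rewrite leqn0 => /eqP n0; subst n; exists x.
rewrite leq_eqVlt => /predU1P[nm|/IH[x' [x'x pos_x']]]; first by subst n; exists x.
have [h [ih [_ _ h_pos _]]] := i_step m.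
by exists (h x'); rewrite ih; split=> // /pos_x'/h_pos.
Qed.

(** Every element is present at all late stages, so finitely many elements can be brought to a
    common stage. *)
Lemma limit_elem y : exists n, forall m, (n <= m)%N -> exists x : X m, i m x = y.
Proof.
have [n [x <-]] := i_surj y; exists n => m /(limit_lift x)[x' [<- _]].
by exists x'.
Qed.

Lemma limit_pos_elem y : limit_pos y ->
  exists n, forall m, (n <= m)%N -> exists2 x : X m, ext_pos x & i m x = y.
Proof.
move=> [n [x [pos_x <-]]]; exists n => m /(limit_lift x)[x' [<- pos_x']].
by exists x'; first exact: pos_x'.
Qed.
End Limit.

(** * Iterated refinement *)

Section UnitaryClosure.
Variables (P U : set nat).
Hypotheses (P_mul : multiplicative_subsemigroup P) (P1 : P 1%N).
Hypotheses (U_mul : multiplicative_subsemigroup U) (U1 : U 1%N) (U_P : forall u, U u -> P u).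

Lemma unitary_extension_trans (M N K : nmodType) (B : M -> Prop) (C : N -> Prop)
    (D : K -> Prop) (g : {additive M -> N}) (f : {additive N -> K}) :
  (forall x y, D x -> D y -> D (x + y)) ->
  unitary_extension B C g -> unitary_extension C D f ->
  unitary_extension B D (f \o g).
Proof.
move=> DD [gI gC gcof gU gp] [fI fD fcof fU fp]; split.
- exact: inj_comp.
- by move=> x; rewrite gC fD.
- move=> b; have [m [c [Dc bc]]] := fcof b; have [a [d [Cd md]]] := gcof m.
  exists a, (c + f d); split; first by apply: (DD) => //; apply/fD.
  by rewrite addrA bc -raddfD md.
- move=> a0 a1 b /= eq_b; have [m bm] := fU _ _ _ eq_b.
  have [|a ma] := gU a0 a1 m; last by exists a; rewrite bm ma.
  by apply: fI; rewrite raddfD -bm.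
- move=> m a b m0 /= eq_b; have [n bn] := fp _ _ _ m0 eq_b.
  have [|a' na'] := gp m a n m0; last by exists a'; rewrite bn na'.
  by apply: fI; rewrite raddfMn -bn.
Qed.

(** Every equation between positive elements of the limit already holds at some finite stage and is
    refined at the next one. *)
Lemma unitary_refinement_closure (A : nmodType) (C : A -> Prop) :
  admissible_cone P U C ->
  exists (L : nmodType) (D : L -> Prop) (f : {additive A -> L}),
    [/\ admissible_cone P U D, unitary_extension C D f, refines D D id &
        (forall x, C x) -> forall z, D z].
Proof.
move=> admC.
pose Inv (X : extension A) := [/\ admissible_cone P U (@ext_pos _ X),
  unitary_extension C (@ext_pos _ X) (ext_emb X) &
  (forall x, C x) -> forall z : X, ext_pos z].
pose Step (X Y : extension A) (h : X -> Y) :=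
  refines (@ext_pos _ X) (@ext_pos _ Y) h.
have next X : Inv X -> exists (Y : extension A) (h : {additive X -> Y}),
    Inv Y /\ good_step Step h.
  move=> [admX extX totX].
  have [N [D [h [admN extN refN totN]]]] := refinement_step P_mul P1 U_mul U1 U_P admX.
  exists (Extension D (h \o ext_emb X)), h.
  have [[_ DD _] _ _] := admN; split; last first.
    by case: extN => hI hD _ _ _; split=> // x px; apply/hD.
  by split=> // [|CT]; [apply: unitary_extension_trans extX extN | apply/totN/totX].
have X0_inv : Inv (@Extension A A C idfun).
  split=> //; split=> //.
  - by move=> b; exists b, 0; rewrite addr0; case: admC => -[].
  - by move=> a0 a1 b _; exists b.
  - by move=> m a b _ _; exists b.
have [L [X [i [X_inv i_inj i_emb i_surj i_step]]]] := chain_limit next X0_inv.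
have lift1 := limit_elem i_surj i_step; have liftD := limit_pos_elem i_step.
set D := limit_pos i in liftD.
have D_i n x : ext_pos x -> D (i n x) by exists n, x.
exists L, D, (i 0%N \o ext_emb (X 0%N)); split.
- split; [split|..].
  + by rewrite -(raddf0 (i 0%N)); apply: D_i; case: (X_inv 0%N) => -[[]].
  + move=> y z /liftD[n yn] /liftD[m zm].
    have [x px <-] := yn _ (leq_addr m n); have [w pw <-] := zm _ (leq_addl n m).
    by rewrite -raddfD; apply: D_i; case: (X_inv (n + m)%N) => -[[_ CD _] _ _] _ _; apply: CD.
  + move=> y z /liftD[n yn] /liftD[m zm].
    have [x px <-] := yn _ (leq_addr m n); have [w pw <-] := zm _ (leq_addl n m).
    case: (X_inv (n + m)%N) => -[[_ _ CK] _ _] _ _.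
    rewrite -raddfD -(raddf0 (i (n + m)%N)) => /i_inj xw.
    by rewrite (CK x w).
  + move=> p Pp y z; have [n yn] := lift1 y; have [m zm] := lift1 z.
    have [x <-] := yn _ (leq_addr m n); have [w <-] := zm _ (leq_addl n m).
    rewrite -!raddfMn => /i_inj; case: (X_inv (n + m)%N) => -[_ tf _] _ _.
    by move=> /(tf p Pp)->.
  + move=> u Uu y; have [n yn] := lift1 y => /liftD[m zm].
    have [x xy] := yn _ (leq_addr m n); have [w pw] := zm _ (leq_addl n m).
    rewrite -xy -raddfMn => /i_inj wx; apply: D_i.
    by case: (X_inv (n + m)%N) => -[_ _ unp] _ _; apply: (unp u); rewrite -?wx.
- split=> /=.
  + by case: (X_inv 0%N) => _ [emb_inj _ _ _ _] _; exact: (inj_comp (i_inj 0%N) emb_inj).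
  + move=> x; split=> [Cx|/liftD[n]].
      by apply: D_i; case: (X_inv 0%N) => _ [_ <-] _.
    move=> /(_ n (leqnn n))[z pz]; rewrite -(i_emb n) => /i_inj zx.
    by case: (X_inv n) => _ [_ -> _ _ _] _; rewrite -zx.
  + move=> y; have [n /(_ n (leqnn n))[x <-]] := lift1 y.
    case: (X_inv n) => _ [_ _ /(_ x)[a [c [pc xc]]] _ _] _.
    by exists a, (i n c); split; [apply: D_i | rewrite -raddfD xc i_emb].
  + move=> a0 a1 y; have [n /(_ n (leqnn n))[x <-]] := lift1 y.
    rewrite -!(i_emb n) -raddfD => /i_inj; case: (X_inv n) => _ [_ _ _ uni _] _.
    by move=> /uni[a ->]; exists a; rewrite i_emb.
  + move=> m a y m0; have [n /(_ n (leqnn n))[x <-]] := lift1 y.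
    rewrite -!(i_emb n) -raddfMn => /i_inj; case: (X_inv n) => _ [_ _ _ _ pure] _.
    by move=> /(pure m a x m0)[a' ->]; exists a'; rewrite i_emb.
- move=> a0 a1 b0 b1 /liftD[n0 H0] /liftD[n1 H1] /liftD[n2 H2] /liftD[n3 H3].
  pose n := (n0 + n1 + n2 + n3)%N.
  have [|x0 p0 <-] := H0 n; first by rewrite /n; lia.
  have [|x1 p1 <-] := H1 n; first by rewrite /n; lia.
  have [|y0 q0 <-] := H2 n; first by rewrite /n; lia.
  have [|y1 q1 <-] := H3 n; first by rewrite /n; lia.
  rewrite -!raddfD => /i_inj eq_xy; have [h [ih [_ _ _ refh]]] := i_step n.
  have [c00 [c01 [c10 [c11 [[? ? ? ?] [e0 e1 e2 e3]]]]]] := refh _ _ _ _ p0 p1 q0 q1 eq_xy.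
  exists (i _ c00), (i _ c01), (i _ c10), (i _ c11); split; first by split; apply: D_i.
  by rewrite -!raddfD -e0 -e1 -e2 -e3 !ih.
- move=> CT y; have [n [x <-]] := i_surj y; apply: D_i.
  by case: (X_inv n) => _ _; apply.
Qed.
End UnitaryClosure.

(** * Partially ordered groups *)

(** A copy of [L] whose type records both hypotheses, so that the group and order structures can be
    attached to it. *)
Definition ordered_hull (L : nmodType) (D : L -> Prop)
  (has_opp : forall x : L, exists y, x + y = 0) (DC : conical_submonoid D) : Type := L.

Section OrderedHull.
Variables (L : nmodType) (D : L -> Prop).
Hypotheses (has_opp : forall x : L, exists y, x + y = 0) (DC : conical_submonoid D).

Let B := ordered_hull has_opp DC.
HB.instance Definition _ := GRing.Nmodule.on B.

Let opp (x : B) : B := sval (cid (has_opp x)).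

Let addNr : left_inverse (0 : B) opp +%R.
Proof. by move=> x; rewrite addrC; exact: svalP (cid (has_opp x)). Qed.

HB.instance Definition _ := GRing.Nmodule_isZmodule.Build B addNr.

Let le (x y : B) : bool := `[< D (y - x) >].

Let le_refl : reflexive le.
Proof. by move=> x; apply/asboolP; rewrite subrr; case: DC. Qed.

Let le_anti : antisymmetric le.
Proof.
move=> x y /andP[/asboolP xy /asboolP yx]; case: DC => _ _ DK.
have yx0 : (y - x) + (x - y) = 0 by rewrite addrA subrK subrr.
exact/esym/subr0_eq/(DK _ _ xy yx yx0).
Qed.

Let le_trans : transitive le.
Proof.
move=> y x z /asboolP xy /asboolP yz; apply/asboolP; case: DC => _ DD _.
have -> : z - x = (z - y) + (y - x) by rewrite addrA subrK.
exact: DD.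
Qed.

HB.instance Definition _ := Order.Le_isPOrder.Build ring_display B le_refl le_anti le_trans.

Lemma ordered_hull_exists : exists (G : porderZmodType) (g : {additive L -> G}),
  [/\ injective g, forall z, exists x, g x = z &
      forall x y, g x <= g y <-> exists2 c, D c & x + c = y].
Proof.
pose g (x : L) : B := x.
have g_nmod : nmod_morphism g by [].
pose gA := GRing.isNmodMorphism.Build L B g g_nmod.
exists B, (HB.pack_for {additive L -> B} g gA); split=> //= [z|x y]; first by exists z.
split=> [/asboolP Dxy|[c Dc <-]].
  by exists (g y - g x) => //; apply: etrans (addrC _ _) (subrK (g x) (g y)).
have e : g (x + c) - g x = c by exact: etrans (addrC _ _) (addKr (g x) (g c)).
by apply/asboolP; exact: (eq_ind_r D Dc e).
Qed.
End OrderedHull.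

(** * Alternating refinement and division *)

Section DivisibleClosure.
Variable P : set nat.
Hypotheses (P_mul : multiplicative_subsemigroup P) (P1 : P 1%N).

Let divides (X Y : nmodType) (h : X -> Y) :=
  forall p a, (0 < p)%N -> exists2 u, u *+ p = h a &
    forall x y, x + a = y + a -> h x + u = h y + u.

(** Each stage adjoins refinements and then quotients. The factors of [P] lost in reflecting the
    order multiply along the chain and stay in [P]. *)
Lemma divisible_refinement_closure (A : nmodType) :
  cone A -> torsion_free_for P A ->
  exists (L : nmodType) (f : {additive A -> L}),
    [/\ refinement_cone L, torsion_free_for P L, normally_divisible L, injective f &
        forall x y, alg_le (f x) (f y) -> exists2 p, P p & alg_le (x *+ p) (y *+ p)].
Proof.
move=> coneA tfA.
pose top (M : nmodType) := fun _ : M => True.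
pose Inv (X : extension A) := [/\ cone X, torsion_free_for P X,
  injective (ext_emb X) & forall x y, alg_le (ext_emb X x) (ext_emb X y) ->
    exists2 p, P p & alg_le (x *+ p) (y *+ p)].
pose Step (X Y : extension A) (h : X -> Y) := refines (top X) (top Y) h /\ divides h.
have next X : Inv X -> exists (Y : extension A) (h : {additive X -> Y}),
    Inv Y /\ good_step Step h.
  move=> [coneX tfX injX leX].
  have admX : admissible_cone P P (top X).
    by split=> //; split=> // x y _ _ /coneX[].
  have [N [D [g [[[_ _ coneN] tfN _] [gI _ _ gU _] refN /(_ (fun _ => I)) DT]]]] :=
    refinement_step P_mul P1 P_mul P1 (fun _ => id) admX.
  have {}coneN : cone N.
    move=> x y xy0; rewrite (coneN x y) //; split=> //.
    by apply: (coneN y x) => //; rewrite addrC.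
  have [K [f [coneK tfK fI fle fdiv]]] := division_step P_mul P1 coneN tfN.
  exists (Extension (top K) (f \o g \o ext_emb X)), (f \o g); split.
    split=> //=; first exact: (inj_comp fI (inj_comp gI injX)).
    (* Division costs the factor [p]; unitarity of the refinement map then brings the difference
       back to the stage [X]. *)
    move=> x y /fle[p Pp [z]]; rewrite -!raddfMn => gz; have [w zw] := gU _ _ _ gz.
    have /leX[q Qq le_q] : alg_le (ext_emb X (x *+ p)) (ext_emb X (y *+ p)).
      by exists w; apply: gI; rewrite raddfD -zw.
    by exists (p * q)%N; rewrite ?mulrnA //; case: P_mul => _ _; apply.
  split=> //=; first exact: inj_comp.
  split=> [a0 a1 b0 b1 _ _ _ _ eq_ab|p a p0].
    have [//|//|//|//|c00 [c01 [c10 [c11 [_ [e0 e1 e2 e3]]]]]] := refN _ _ _ _ _ _ _ _ eq_ab.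
    exists (f c00), (f c01), (f c10), (f c11); split=> //.
    by rewrite /= e0 e1 e2 e3 !raddfD.
  have [u ua uP] := fdiv p (g a) p0; exists u => // x y xya.
  by apply: uP; rewrite -!raddfD xya.
have X0_inv : Inv (@Extension A A (top A) idfun).
  by split=> // x y xy; exists 1%N.
have [L [X [i [X_inv i_inj i_emb i_surj i_step]]]] := chain_limit next X0_inv.
have lift1 := limit_elem i_surj i_step.
exists L, (i 0%N \o ext_emb (X 0%N)); split.
- split.
    move=> y z; have [n yn] := lift1 y; have [m zm] := lift1 z.
    have [x <-] := yn _ (leq_addr m n); have [w <-] := zm _ (leq_addl n m).
    rewrite -raddfD -(raddf0 (i (n + m)%N)) => /i_inj xw.
    by case: (X_inv (n + m)%N) => /(_ x w xw)[-> ->].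
  move=> a0 a1 b0 b1; have [n0 H0] := lift1 a0; have [n1 H1] := lift1 a1.
  have [n2 H2] := lift1 b0; have [n3 H3] := lift1 b1.
  pose n := (n0 + n1 + n2 + n3)%N.
  have [|x0 <-] := H0 n; first by rewrite /n; lia.
  have [|x1 <-] := H1 n; first by rewrite /n; lia.
  have [|y0 <-] := H2 n; first by rewrite /n; lia.
  have [|y1 <-] := H3 n; first by rewrite /n; lia.
  rewrite -!raddfD => /i_inj eq_xy; have [h [ih [_ _ _ [refh _]]]] := i_step n.
  have [//|//|//|//|c00 [c01 [c10 [c11 [_ [e0 e1 e2 e3]]]]]] := refh _ _ _ _ _ _ _ _ eq_xy.
  exists (i _ c00), (i _ c01), (i _ c10), (i _ c11).
  by rewrite -!raddfD -e0 -e1 -e2 -e3 !ih.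
- move=> p Pp y z; have [n yn] := lift1 y; have [m zm] := lift1 z.
  have [x <-] := yn _ (leq_addr m n); have [w <-] := zm _ (leq_addl n m).
  rewrite -!raddfMn => /i_inj; case: (X_inv (n + m)%N) => _ tf _ _.
  by move=> /(tf p Pp)->.
- move=> p s a p0; have [n0 an] := lift1 a.
  (* The finite set lies in a single stage, and the quotient chosen at the next stage serves all its
     elements. *)
  have [n1 sn] : exists n, forall m, (n <= m)%N -> forall x, x \in s -> exists x', i m x' = x.
    elim: s => [|y s [n sn]]; first by exists 0%N.
    have [k yk] := lift1 y; exists (k + n)%N => m knm x; rewrite inE => /predU1P[->|/sn].
      by apply: yk; lia.
    by apply; lia.
  pose n := (n0 + n1)%N; have [|a' aa'] := an n; first by rewrite /n; lia.
  have [h [ih [_ _ _ [_ divh]]]] := i_step n.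
  have [u ua uP] := divh p a' p0; exists (i _ u); split.
    by rewrite -raddfMn ua ih.
  move=> x y xs ys; have [|x' <-] := sn n _ x xs; first by rewrite /n; lia.
  have [|y' <-] := sn n _ y ys; first by rewrite /n; lia.
  by rewrite -aa' -!raddfD => /i_inj/uP; rewrite -!ih -!raddfD => ->.
- exact: (inj_comp (i_inj 0%N) (let: And4 _ _ e _ := X_inv 0%N in e)).
move=> x y [z]; have [n /(_ n (leqnn n))[w <-]] := lift1 z.
rewrite /= -!(i_emb n) -raddfD => /i_inj xwy.
by case: (X_inv n) => _ _ _; apply; exists w.
Qed.
End DivisibleClosure.

(** * Riesz group extensions with torsion-free quotient *)

Lemma torsion_free_cokernel (A B : zmodType) (f : {additive A -> B}) :
  (forall m b, (0 < m)%N -> range f (b *+ m) -> range f b) -> torsion_free (cokernel f).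
Proof.
move=> pure m m0 x y; pose S : zmodClosed B := image_pred f.
pose pr0 : B -> Quotient.quot S := \pi_(Quotient.quot S).
have pr_nmod : nmod_morphism pr0.
  split; last exact: Quotient.pi_add.
  exact: (@pi_zeror _ _ _ _ _ (Quotient.quot S : zmodQuotType _ _ _ _)).
pose prA := GRing.isNmodMorphism.Build B (Quotient.quot S) pr0 pr_nmod.
pose pr := HB.pack_for {additive B -> Quotient.quot S} pr0 prA.
have pr_eq u v : pr u = pr v <-> range f (u - v).
  have prE : (u - v \in S) = (pr0 u == pr0 v) := Quotient.idealrBE S u v.
  by split=> [/eqP|uv]; [rewrite -prE => /asboolP | apply/eqP; rewrite -prE; apply/asboolP].
have pr_surj z : exists u, pr u = z by exists (repr z); exact: reprK.
have [u <-] := pr_surj x; have [v <-] := pr_surj y.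
(* Torsion-freeness of the quotient is purity of the image, applied to the difference of
   representatives. *)
by rewrite -!raddfMn => /pr_eq; rewrite -mulrnBl => /(pure m _ m0) /pr_eq.
Qed.

(** The positive cone of [A] is refined inside a monoid that is again a group. Statements (b) and
    (d) differ only in [U]. *)
Lemma riesz_group_extension (P U : set nat) (A : porderZmodType) :
  multiplicative_subsemigroup P -> P 1%N -> multiplicative_subsemigroup U -> U 1%N ->
  (forall u, U u -> P u) -> po_group A -> directed A -> torsion_free_for P A ->
  (forall u, U u -> forall x : A, 0 <= x *+ u -> 0 <= x) ->
  exists (B : porderZmodType) (f : {additive A -> B}),
    [/\ riesz_group B, torsion_free_for P B,
        forall u, U u -> forall x : B, 0 <= x *+ u -> 0 <= x &
        po_embedding f /\ cofinal (@po_le B) f /\ torsion_free (cokernel f)].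
Proof.
move=> P_mul P1 U_mul U1 U_P poA dirA tfA unpA.
have admA : admissible_cone P U (fun x : A => 0 <= x).
  split=> //; split=> // [x y x0 y0|x y x0 y0 xy0].
    by apply: le_trans y0 _; have := poA _ _ y x0; rewrite add0r.
  apply: le_anti; rewrite x0 andbT -[leRHS]xy0.
  by have := poA _ _ x y0; rewrite add0r addrC.
have [L [D [f [[DC tfL unpD] [fI fD fcof fU fpure] refD _]]]] :=
  unitary_refinement_closure P_mul P1 U_mul U1 U_P admA.
(* Each element has a complement summing into the image of the group [A], which makes it
   invertible. *)
have has_opp (x : L) : exists y, x + y = 0.
  have [a [c [_ xc]]] := fcof x; exists (c + f (- a)).
  by rewrite addrA xc -raddfD subrr raddf0.
have [B [g [gI g_surj g_le]]] := ordered_hull_exists has_opp DC.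
have [D0 DD DK] := DC.
have ge0 x : 0 <= g x <-> D x.
  rewrite -(raddf0 g); split=> [/g_le[c Dc]|Dx]; first by rewrite add0r => <-.
  by apply/g_le; exists x; rewrite ?add0r.
have poB : po_group B.
  move=> x y z; have [x' <-] := g_surj x; have [y' <-] := g_surj y; have [z' <-] := g_surj z.
  move=> /g_le[c Dc <-]; rewrite -!raddfD; apply/g_le; exists c => //.
  by rewrite addrAC.
have subD (x y : B) : x <= y -> exists2 c, D c & y - x = g c.
  move=> xy; have [c gc] := g_surj (y - x); exists c => //; apply/ge0.
  by rewrite gc -(subrr x); apply: poB.
have leD c (x y : B) : D c -> y = x + g c -> x <= y.
  by move=> /ge0 gc ->; have := poB _ _ x gc; rewrite add0r addrC.
exists B, (g \o f); split.
- split=> //.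
    (* From [y + c = f a] and [a = a1 - a2], the element [y] is [f a1] minus [c + f a2]. *)
    move=> x; have [y <-] := g_surj x; have [a [c [Dc yc]]] := fcof y.
    have [a1 [a2 [a10 a20 eq_a]]] := dirA a.
    exists (g (f a1)), (g (c + f a2)); split; [by apply/ge0/fD | by apply/ge0/DD => //; apply/fD|].
    apply/eqP; rewrite eq_sym subr_eq -raddfD; apply/eqP.
    by rewrite addrA yc -raddfD eq_a subrK.
  move=> x0 x1 y0 y1 le00 le01 le10 le11.
  have [p Dp ep] := subD _ _ le00; have [q Dq eq] := subD _ _ le11.
  have [r Dr er] := subD _ _ le10; have [s Ds es] := subD _ _ le01.
  (* Both sides equal [y0 + y1 - x0 - x1]; refining this equation produces the interpolant. *)
  have eq_pqrs : p + q = r + s.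
    apply: gI; rewrite !raddfD -ep -eq -er -es.
    by rewrite addrACA [in RHS]addrACA (addrC (- x1)).
  have [c00 [c01 [c10 [c11 [[D00 D01 D10 D11] [/= e0 e1 e2 e3]]]]]] :=
    refD _ _ _ _ Dp Dq Dr Ds eq_pqrs.
  have yE (u v : B) w : u - v = w -> u = v + w by move=> <-; rewrite addrC subrK.
  have y0E := yE _ _ _ ep; have y1E := yE _ _ _ es; have y0E' := yE _ _ _ er.
  (* The four refining elements are exactly the differences between this element and the four
     bounds. *)
  exists (x0 + g c01); split.
  + exact: leD D01 _.
  + apply: leD D10 _; apply: (addIr (g c00)).
    by rewrite -addrA -raddfD (addrC c01) -e0 -y0E y0E' -addrA -raddfD (addrC c10) -e2.
  + by apply: leD D00 _; rewrite y0E e0 raddfD addrAC addrA.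
  + by apply: leD D11 _; rewrite y1E e3 raddfD addrA.
- move=> p Pp x y; have [x' <-] := g_surj x; have [y' <-] := g_surj y.
  by rewrite -!raddfMn => /gI/(tfL p Pp)->.
- move=> u Uu x; have [x' <-] := g_surj x; rewrite -raddfMn => /ge0/(unpD u Uu).
  by move/ge0.
- split; first by split=> [|x]; [exact: inj_comp | rewrite fD; exact: iff_sym (ge0 _)].
  split.
    move=> x; have [y <-] := g_surj x; have [a [c [Dc yc]]] := fcof y.
    by exists a; apply/g_le; exists c.
  apply: torsion_free_cokernel => m x m0 [a _]; have [y <-] := g_surj x.
  rewrite -raddfMn => /gI/esym/(fpure m a y m0)[a' ->]; by exists a'.
Qed.

(** * Deduction of (a) to (d) from the limit constructions *)

Theorem corollary1p15 :
  forall P : set nat, multiplicative_subsemigroup P ->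
  (forall A : nmodType, cone A -> torsion_free_for P A ->
     exists (B : nmodType) (f : {additive A -> B}),
       refinement_cone B /\ torsion_free_for P B /\ strongly_unitary f)
  /\
  (forall A : porderZmodType, po_group A -> directed A ->
     torsion_free_for P A ->
     exists (B : porderZmodType) (f : {additive A -> B}),
       riesz_group B /\ torsion_free_for P B /\
       po_embedding f /\ cofinal (@po_le B) f /\ torsion_free (cokernel f))
  /\
  (forall A : nmodType, cone A -> torsion_free_for P A ->
     unperforated_for P (@alg_le A) ->
     exists (B : nmodType) (f : {additive A -> B}),
       refinement_cone B /\ torsion_free_for P B /\
       unperforated_for P (@alg_le B) /\ normally_divisible B /\
       order_embedding f)
  /\
  (forall A : porderZmodType, po_group A -> directed A ->
     unperforated_for P (@po_le A) ->
     exists (B : porderZmodType) (f : {additive A -> B}),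
       riesz_group B /\ unperforated_for P (@po_le B) /\
       po_embedding f /\ cofinal (@po_le B) f /\ torsion_free (cokernel f)).
Proof.
(* The constructions use the exponent 1; adjoining it to [P] changes neither torsion-freeness nor
   unperforation. *)
move=> P P_mul; pose Q : set nat := fun p => P p \/ p = 1%N.
have Q1 : Q 1%N by right.
have P_gt0 p : P p -> (0 < p)%N by case: P_mul => PN _ _ /PN.
have Q_mul : multiplicative_subsemigroup Q.
  split=> [p [/P_gt0//|->//]||p q]; first by exists 1%N.
  case: P_mul => _ _ PM [Pp|->] [Pq|->]; rewrite ?mul1n ?muln1; [left|left|left|right] => //.
  exact: PM.
have one_mul : multiplicative_subsemigroup (fun p => p = 1%N).
  by split=> [p ->||p q -> ->] //; exists 1%N.
have PQ p : P p -> Q p by left.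
have tfQ (M : nmodType) : torsion_free_for P M -> torsion_free_for Q M.
  by move=> tfM p [/tfM//|->] x y; rewrite !mulr1n.
split; [|split; [|split]].
- move=> A coneA /tfQ tfA.
  have [|L [D [f [[[_ _ DK] tfL _] [fI _ fcof fU fp] refD DT]]]] :=
    @unitary_refinement_closure Q Q Q_mul Q1 Q_mul Q1 (fun _ => id) A (fun _ => True).
    by split=> //; split=> // x y _ _ /coneA[].
  have {}DT := DT (fun _ => Logic.I); exists L, f; split.
    split=> [x y xy0|a0 a1 b0 b1 eq_ab].
      by split; [apply: (DK x y) | apply: (DK y x)]; rewrite // addrC.
    have [c00 [c01 [c10 [c11 [_ ec]]]]] :=
      refD a0 a1 b0 b1 (DT _) (DT _) (DT _) (DT _) eq_ab.
    by exists c00, c01, c10, c11.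
  split; first by move=> p /PQ; apply: tfL.
  split=> // [b|a0 a1 b /fU[a ->]|m b m0 [a _ /esym eq_a]].
  + by have [a [c [_ bc]]] := fcof b; exists a, c.
  + by exists a.
  + by have [a' ->] := fp m a b m0 eq_a; exists a'.
- move=> A poA dirA /tfQ tfA.
  (* With [U] = {1} no division of positive elements is imposed. *)
  have [||B [f [rB tfB _ fP]]] :=
    riesz_group_extension Q_mul Q1 one_mul (erefl _) _ poA dirA tfA.
  + by move=> _ ->.
  + by move=> _ -> x; rewrite mulr1n.
  by exists B, f; split=> //; split=> // p /PQ; apply: tfB.
- move=> A coneA tfA unpA.
  have [L [f [rL tfL ndL fI fle]]] :=
    divisible_refinement_closure Q_mul Q1 coneA (tfQ _ tfA).
  exists L, f; split=> //; split; first by move=> p /PQ; apply: tfL.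
  split.
    (* Write the difference [z] as [w *+ p]; torsion-freeness then cancels [p]. *)
    move=> p Pp x y [z xzy]; have [w [wz _]] := ndL p [::] z (P_gt0 p Pp).
    by exists w; apply: (tfL p (PQ p Pp)); rewrite mulrnDl wz.
  split=> //; split=> // x y; split=> [[z <-]|].
    by exists (f z); rewrite raddfD.
  by move=> /fle[p [/unpA|->]] //; apply.
- move=> A poA dirA unpA.
  have ge0 p : Q p -> forall x : A, 0 <= x *+ p -> 0 <= x.
    move=> [Pp|->] x; last by rewrite mulr1n.
    by move=> x0; apply: (unpA p Pp); rewrite mul0rn.
  (* Equal multiples are comparable both ways, so unperforation and antisymmetry give equality. *)
  have tfA : torsion_free_for P A.
    by move=> p Pp x y eq_xy; apply: le_anti; apply/andP; split; apply: (unpA p Pp); rewrite eq_xy;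
       apply: lexx.
  have [B [f [rB tfB unpB fP]]] :=
    riesz_group_extension Q_mul Q1 Q_mul Q1 (fun _ => id) poA dirA (tfQ _ tfA) ge0.
  exists B, f; split=> //; split=> // p /PQ Qp x y xy.
  (* Translation reduces unperforation to division of the positive element [(y - x) *+ p]. *)
  have [poB _ _] := rB; have := poB _ _ (- (x *+ p)) xy.
  rewrite subrr -mulrnBl => /(unpB p Qp) yx; have := poB _ _ x yx.
  by rewrite add0r subrK.
Qed.
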